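(* Let $k$ be a field, let $n\ge 1$, and let $H_1,\ldots,H_n$ be quasitriangular Hopf algebras over $k$ with universal R-matrices $R_1,\ldots,R_n$, where $R_m=\sum_{i_m}s_{i_m}\otimes t_{i_m}\in H_m\otimes H_m$ for $m=1,\ldots,n$. Put $H=H_1\otimes\cdots\otimes H_n$ and $$R=\sum_{i_1,\ldots,i_n}s_{i_1}\otimes\cdots\otimes s_{i_n}\otimes t_{i_1}\otimes\cdots\otimes t_{i_n}\in H\otimes H .$$ For each $m=1,\ldots,n$ let $U_m,V_m,W_m$ be $H_m$-modules, and regard $U=U_1\otimes\cdots\otimes U_n$, $V=V_1\otimes\cdots\otimes V_n$, $W=W_1\otimes\cdots\otimes W_n$ as $H$-modules. For $H$-modules $X=X_1\otimes\cdots\otimes X_n$ and $Y=Y_1\otimes\cdots\otimes Y_n$ of this form (each $X_m$, $Y_m$ an $H_m$-module), let $C^R_{X,Y}:X\otimes Y\to Y\otimes X$ be the linear map $$C^R_{X,Y}(x_1\otimes\cdots\otimes x_n\otimes y_1\otimes\cdots\otimes y_n)=\sum_{i_1,\ldots,i_n}(t_{i_1}\rhd y_1)\otimes\cdots\otimes(t_{i_n}\rhd y_n)\otimes(s_{i_1}\rhd x_1)\otimes\cdots\otimes(s_{i_n}\rhd x_n),$$ that is, $C^R_{X,Y}=\tau_{X,Y}\circ(R\,\rhd)$, where $\tau_{X,Y}(x\otimes y)=y\otimes x$. Then: (a) The map $C^R_{V,W}:V\otimes W\to W\otimes V$ is an isomorphism of $H_1\otimes\cdots\otimes H_n$-modules.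 (b) The following equality of linear maps $U\otimes V\otimes W\to W\otimes V\otimes U$ holds: $$(C^R_{V,W}\otimes \mathrm{id}_U)(\mathrm{id}_V\otimes C^R_{U,W})(C^R_{U,V}\otimes \mathrm{id}_W)=(\mathrm{id}_W\otimes C^R_{U,V})(C^R_{U,W}\otimes \mathrm{id}_V)(\mathrm{id}_U\otimes C^R_{V,W}).$$
   Context: All tensor products are over $k$. A quasitriangular Hopf algebra $(A,\mu,\eta,\Delta,\varepsilon,S,S^{-1},R)$ is a Hopf algebra over $k$ with invertible antipode $S$, together with an invertible element $R\in A\otimes A$ (the universal R-matrix) such that $\Delta^{op}(x)=R\,\Delta(x)\,R^{-1}$ for all $x\in A$, where $\Delta^{op}=\tau_{A,A}\circ\Delta$ and $\tau_{A,A}(a\otimes b)=b\otimes a$, and such that $$(\Delta\otimes \mathrm{id}_A)(R)=R_{13}R_{23},\qquad (\mathrm{id}_A\otimes\Delta)(R)=R_{13}R_{12}.$$ Here, for $R=\sum_i s_i\otimes t_i$, $R_{12}=\sum_i s_i\otimes t_i\otimes 1$, $R_{13}=\sum_i s_i\otimes 1\otimes t_i$, $R_{23}=\sum_i 1\otimes s_i\otimes t_i$ in $A\otimes A\otimes A$. The algebra $H=H_1\otimes\cdots\otimes H_n$ carries the tensor product algebra structure and the tensor product coproduct, given in Sweedler notation ($\Delta(x)=\sum_{(x)}x'\otimes x''$) by $$\Delta(x_1\otimes\cdots\otimes x_n)=\sum x_1'\otimes\cdots\otimes x_n'\otimes x_1''\otimes\cdots\otimes x_n'' .$$ The symbol $\rhd$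 denotes a module action (modules are left modules). If $X_m$ is an $H_m$-module for each $m$, then $H$ acts on $X_1\otimes\cdots\otimes X_n$ by $(h_1\otimes\cdots\otimes h_n)\rhd(x_1\otimes\cdots\otimes x_n)=(h_1\rhd x_1)\otimes\cdots\otimes(h_n\rhd x_n)$. If $X,Y$ are $H$-modules, then $X\otimes Y$ is an $H\otimes H$-module componentwise and an $H$-module through the coproduct: $h\rhd(x\otimes y)=\Delta(h)\rhd(x\otimes y)$. *)

(* Defs.v *)
From HB Require Import structures.
From mathcomp Require Import all_boot all_algebra.
From mathcomp Require Import boolp classical_sets.
From mathcomp Require Import freeg.

Set Implicit Arguments.
Unset Strict Implicit.
Unset Printing Implicit Defensive.

Import GRing.Theory.
Local Open Scope ring_scope.
Local Open Scope quotient_scope.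

Local Notation bilin f := (bilinear_for *:%R *:%R f).

Section LinearFacts.
Variables (k : pzRingType) (U V : lmodType k) (f : U -> V).
Hypothesis lf : linear f.

Lemma lin0 : f 0 = 0.
Proof. by have := lf (-1) 0 0; rewrite scaler0 addr0 scaleN1r addNr. Qed.

Lemma linD x y : f (x + y) = f x + f y.
Proof. by have := lf 1 x y; rewrite !scale1r. Qed.

Lemma linZ a x : f (a *: x) = a *: f x.
Proof. by have := lf a x 0; rewrite lin0 !addr0. Qed.

Lemma lin_sum (J : Type) (r : seq J) (P : pred J) (F : J -> U) :
  f (\sum_(j <- r | P j) F j) = \sum_(j <- r | P j) f (F j).
Proof. by apply: (big_morph f linD lin0). Qed.

End LinearFacts.

Section FreegLift.
Variables (k : fieldType) (X : choiceType).

Lemma fglift_linear (V : lmodType k) (f : X -> V) : linear (@fglift k V X f).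
Proof.
have hB : zmod_morphism (fglift f) := lift_is_additive f.
have h0 : fglift f 0 = 0 by rewrite -[X in fglift f X](subrr 0) hB subrr.
have hD x y : fglift f (x + y) = fglift f x + fglift f y.
  by rewrite -[y in LHS]opprK -[- y]sub0r !hB h0 sub0r opprK.
move=> a x y; rewrite hD; congr (_ + _).
have hS := big_morph (fglift f) hD h0.
rewrite -[a *: x]/(fgscale a x) /fgscale hS -[x in RHS]freeg_sumE hS.
rewrite scaler_sumr; apply: eq_bigr => z _.
by rewrite !liftU scalerA.
Qed.

Lemma fglift_lin2 (V : lmodType k) (f g : X -> V) a D :
  fglift (fun x => a *: f x + g x) D = a *: fglift f D + fglift g D.
Proof.
rewrite -[D]freeg_sumE !(lin_sum (fglift_linear _)) scaler_sumr -big_split.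
apply: eq_bigr => z _ /=; rewrite !liftU scalerDr !scalerA mulrC //.
Qed.

End FreegLift.

(* lquot is F modulo the subspace spanned by the relators G. *)
Section SpanQuotient.
Variables (k : fieldType) (F : lmodType k) (G : F -> Prop).

Inductive in_span : F -> Prop :=
| in_span0 : in_span 0
| in_span_cons a g x : G g -> in_span x -> in_span (a *: g + x).

Lemma in_spanD x y : in_span x -> in_span y -> in_span (x + y).
Proof.
by move=> + yS; elim=> [|a g {}x Gg _ IH]; rewrite ?add0r // -addrA;
  constructor.
Qed.

Lemma in_spanZ a x : in_span x -> in_span (a *: x).
Proof.
elim=> [|b g {}x Gg _ IH]; first by rewrite scaler0; constructor.
by rewrite scalerDr scalerA; constructor.
Qed.

Definition spanned : {pred F} := fun x => `[< in_span x >].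

Lemma spanned_zmod : zmod_closed spanned.
Proof.
split=> [|x y /asboolP xS /asboolP yS]; apply/asboolP; first exact: in_span0.
by rewrite -scaleN1r; apply: in_spanD => //; apply: in_spanZ.
Qed.

HB.instance Definition _ := GRing.isZmodClosed.Build F spanned spanned_zmod.

Definition lquot : Type := Quotient.quot spanned.
HB.instance Definition _ := Choice.on lquot.
HB.instance Definition _ := GRing.Zmodule.on lquot.

Definition lquot_pi (x : F) : lquot := \pi_(Quotient.quot spanned) x.
Definition lquot_repr (z : lquot) : F := repr (z : Quotient.quot spanned).

Lemma lquot_reprK z : lquot_pi (lquot_repr z) = z.
Proof. exact: reprK. Qed.

Lemma lquot_eq x y : lquot_pi x = lquot_pi y <-> in_span (x - y).
Proof.
split=> [/eqP|]; first by rewrite -Quotient.idealrBE => /asboolP.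
by move=> h; apply/eqP; rewrite -Quotient.idealrBE; apply/asboolP.
Qed.

Lemma lquot_piD x y : lquot_pi (x + y) = lquot_pi x + lquot_pi y.
Proof. exact: Quotient.pi_add. Qed.

Definition lquot_scale (a : k) (z : lquot) : lquot :=
  lquot_pi (a *: lquot_repr z).

Lemma lquot_piZ a x : lquot_pi (a *: x) = lquot_scale a (lquot_pi x).
Proof.
apply/lquot_eq; rewrite -scalerBr; apply: in_spanZ.
by apply/lquot_eq; rewrite lquot_reprK.
Qed.

Fact lquot_scaleA a b z :
  lquot_scale a (lquot_scale b z) = lquot_scale (a * b) z.
Proof. by rewrite -[z]lquot_reprK -!lquot_piZ scalerA. Qed.

Fact lquot_scale1 : left_id 1 lquot_scale.
Proof. by move=> z; rewrite -[z]lquot_reprK -!lquot_piZ scale1r. Qed.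

Fact lquot_scaleDr : right_distributive lquot_scale +%R.
Proof.
move=> a x y; rewrite -[x]lquot_reprK -[y]lquot_reprK -lquot_piD -!lquot_piZ.
by rewrite scalerDr lquot_piD.
Qed.

Fact lquot_scaleDl z : {morph lquot_scale^~ z : a b / a + b}.
Proof.
by move=> a b; rewrite -[z]lquot_reprK -!lquot_piZ scalerDl lquot_piD.
Qed.

HB.instance Definition _ := GRing.Zmodule_isLmodule.Build k lquot
  lquot_scaleA lquot_scale1 lquot_scaleDr lquot_scaleDl.

Lemma lquot_pi_linear : linear lquot_pi.
Proof. by move=> a x y; rewrite lquot_piD lquot_piZ. Qed.

Lemma lquot_rel x a y z : G (x - (a *: y + z)) ->
  lquot_pi x = a *: lquot_pi y + lquot_pi z.
Proof.
move=> Gx; rewrite -lquot_pi_linear; apply/lquot_eq.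
rewrite -[X in in_span X]addr0 -[X in in_span (X + _)]scale1r.
exact: in_span_cons Gx in_span0.
Qed.

Section Lift.
Variables (P : lmodType k) (h : F -> P).
Hypotheses (lh : linear h) (hG : forall g, G g -> h g = 0).

Lemma lquot_liftE x : h (lquot_repr (lquot_pi x)) = h x.
Proof.
have: in_span (lquot_repr (lquot_pi x) - x) by apply/lquot_eq/lquot_reprK.
have hs y : in_span y -> h y = 0.
  elim=> [|a g {}y Gg _ IH]; first exact: lin0 lh.
  by rewrite lh IH hG // scaler0 addr0.
by move/hs/eqP; rewrite linD // -scaleN1r linZ // scaleN1r subr_eq0 => /eqP.
Qed.

Lemma lquot_lift_linear : linear (fun z => h (lquot_repr z)).
Proof.
move=> a x y; rewrite -[x in LHS]lquot_reprK -[y in LHS]lquot_reprK.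
by rewrite -lquot_pi_linear lquot_liftE lh.
Qed.

End Lift.
End SpanQuotient.

(* tens V W is the free vector space on V * W modulo bilinearity, wrapped in a
   record so that unification does not unfold it to the quotient. *)
Section Tensor.
Variables (k : fieldType) (V W : lmodType k).
Implicit Types (v : V) (w : W).

Inductive tens_rel : {freeg (V * W)%type / k} -> Prop :=
| tens_rel_l a v v' w :
    tens_rel (<< (a *: v + v', w) >> - (a *: << (v, w) >> + << (v', w) >>))
| tens_rel_r a v w w' :
    tens_rel (<< (v, a *: w + w') >> - (a *: << (v, w) >> + << (v, w') >>)).

Record tens := Tens { tens_val : lquot tens_rel }.

Let valK : cancel tens_val Tens. Proof. by case. Qed.

HB.instance Definition _ := Choice.copy tens (can_type valK).

Definition tens_zero := Tens 0.
Definition tens_opp z := Tens (- tens_val z).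
Definition tens_add y z := Tens (tens_val y + tens_val z).
Definition tens_scale (a : k) z := Tens (a *: tens_val z).

Let addA : associative tens_add.
Proof. by move=> x y z; congr Tens; apply: addrA. Qed.
Let addC : commutative tens_add.
Proof. by move=> x y; congr Tens; apply: addrC. Qed.
Let add0 : left_id tens_zero tens_add.
Proof. by case=> x; congr Tens; apply: add0r. Qed.
Let addN : left_inverse tens_zero tens_opp tens_add.
Proof. by move=> x; congr Tens; apply: addNr. Qed.

HB.instance Definition _ := GRing.isZmodule.Build tens addA addC add0 addN.

Let scaleA a b z : tens_scale a (tens_scale b z) = tens_scale (a * b) z.
Proof. by congr Tens; apply: scalerA. Qed.
Let scale1 : left_id 1 tens_scale.
Proof. by case=> x; congr Tens; apply: scale1r. Qed.
Let scaleDr : right_distributive tens_scale +%R.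
Proof. by move=> a x y; congr Tens; apply: scalerDr. Qed.
Let scaleDl z : {morph tens_scale^~ z : a b / a + b}.
Proof. by move=> a b; congr Tens; apply: scalerDl. Qed.

HB.instance Definition _ := GRing.Zmodule_isLmodule.Build k tens
  scaleA scale1 scaleDr scaleDl.

Let valP : linear tens_val. Proof. by []. Qed.
Let mkP : linear Tens. Proof. by []. Qed.

Definition tpure v w : tens := Tens (lquot_pi tens_rel << (v, w) >>).

Lemma tpure_bilin : bilin tpure.
Proof.
split=> [w a v v'|v a w w'].
  by congr Tens; apply: lquot_rel (tens_rel_l a v v' w).
by congr Tens; apply: lquot_rel (tens_rel_r a v w w').
Qed.

Lemma tens_sum (z : tens) :
  exists s : seq (V * W), z = \sum_(p <- s) tpure p.1 p.2.
Proof.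
case: z => z; rewrite -[z]lquot_reprK -[lquot_repr z]freeg_sumE.
rewrite (lin_sum (@lquot_pi_linear _ _ _)) (lin_sum mkP).
set D := lquot_repr z.
exists [seq (coeff p D *: p.1, p.2) | p <- dom D].
rewrite [RHS]big_map; apply: eq_bigr => -[v w] _ /=.
rewrite (linZ (tpure_bilin.1 w)) /tpure -(linZ mkP).
rewrite -(linZ (@lquot_pi_linear _ _ _)).
congr (Tens (lquot_pi _ _)); apply/eqP/freeg_eqP => x.
by rewrite coeffZ !coeffU mul1r.
Qed.

Lemma tens_ind (P : tens -> Prop) :
  (forall v w, P (tpure v w)) -> (forall x y, P x -> P y -> P (x + y)) ->
  forall z, P z.
Proof.
move=> hp hD z; have [s ->] := tens_sum z.
have P0 : P 0 by rewrite -(lin0 (tpure_bilin.2 0)).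
by elim/big_ind: _ => // -[].
Qed.

Section Lift.
Variables (P : lmodType k).
Implicit Types (f g : V -> W -> P).

(* The linear map induced by f; meaningful only when f is bilinear. *)
Definition tlift f (z : tens) : P :=
  fglift (fun p : V * W => f p.1 p.2) (lquot_repr (tens_val z)).

Lemma tlift_lin2 f g a z :
  tlift (fun v w => a *: f v w + g v w) z = a *: tlift f z + tlift g z.
Proof. exact: fglift_lin2. Qed.

Lemma eq_tlift f g : f =2 g -> tlift f =1 tlift g.
Proof. by move=> e z; congr tlift; apply/funext => v; apply/funext. Qed.

Variable f : V -> W -> P.
Hypothesis bf : bilin f.

Let kills r : tens_rel r -> fglift (fun p : V * W => f p.1 p.2) r = 0.
Proof.
have hL := fglift_linear (fun p : V * W => f p.1 p.2).
case=> [a v v' w|a v w w']; rewrite (linD hL) -scaleN1r (linZ hL) (linD hL) (linZ hL);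
  rewrite !liftU !scale1r /= scaleN1r; apply/eqP; rewrite subr_eq0.
- by rewrite (bf.1 w).
- by rewrite (bf.2 v).
Qed.

Lemma tlift_linear : linear (tlift f).
Proof.
move=> a x y; rewrite /tlift valP.
exact: (lquot_lift_linear (fglift_linear _) kills).
Qed.

Lemma tliftE v w : tlift f (tpure v w) = f v w.
Proof.
rewrite /tlift /tpure lquot_liftE; [|exact: fglift_linear|exact: kills].
by rewrite liftU scale1r.
Qed.

End Lift.

Lemma tens_ext (P : lmodType k) (f g : tens -> P) : linear f -> linear g ->
  (forall v w, f (tpure v w) = g (tpure v w)) -> f =1 g.
Proof.
by move=> lf lg e; elim/tens_ind => // x y ex ey; rewrite linD // ex ey -linD.
Qed.

End Tensor.

(* mtens V is the unbracketed tensor product of a finite family: the free vector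
   space on the product of the V i modulo multilinearity. *)
Section MTensor.
Variables (k : fieldType) (I : finType) (V : I -> lmodType k).
Implicit Types (x : forall i, V i).

Definition multilinear (P : lmodType k) (f : (forall i, V i) -> P) : Prop :=
  forall x i, linear (fun u : V i => f (dfwith x u)).

Inductive mtens_rel : {freeg {classic forall i, V i} / k} -> Prop :=
| mtens_rel_at x i a (u v : V i) : mtens_rel
    (<< dfwith x (a *: u + v) >> - (a *: << dfwith x u >> + << dfwith x v >>)).

Record mtens := MTens { mtens_val : lquot mtens_rel }.

Let valK : cancel mtens_val MTens. Proof. by case. Qed.

HB.instance Definition _ := Choice.copy mtens (can_type valK).

Definition mtens_zero := MTens 0.
Definition mtens_opp z := MTens (- mtens_val z).
Definition mtens_add y z := MTens (mtens_val y + mtens_val z).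
Definition mtens_scale (a : k) z := MTens (a *: mtens_val z).

Let addA : associative mtens_add.
Proof. by move=> x y z; congr MTens; apply: addrA. Qed.
Let addC : commutative mtens_add.
Proof. by move=> x y; congr MTens; apply: addrC. Qed.
Let add0 : left_id mtens_zero mtens_add.
Proof. by case=> x; congr MTens; apply: add0r. Qed.
Let addN : left_inverse mtens_zero mtens_opp mtens_add.
Proof. by move=> x; congr MTens; apply: addNr. Qed.

HB.instance Definition _ := GRing.isZmodule.Build mtens addA addC add0 addN.

Let scaleA a b z : mtens_scale a (mtens_scale b z) = mtens_scale (a * b) z.
Proof. by congr MTens; apply: scalerA. Qed.
Let scale1 : left_id 1 mtens_scale.
Proof. by case=> x; congr MTens; apply: scale1r. Qed.
Let scaleDr : right_distributive mtens_scale +%R.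
Proof. by move=> a x y; congr MTens; apply: scalerDr. Qed.
Let scaleDl z : {morph mtens_scale^~ z : a b / a + b}.
Proof. by move=> a b; congr MTens; apply: scalerDl. Qed.

HB.instance Definition _ := GRing.Zmodule_isLmodule.Build k mtens
  scaleA scale1 scaleDr scaleDl.

Let valP : linear mtens_val. Proof. by []. Qed.
Let mkP : linear MTens. Proof. by []. Qed.

Definition mpure x : mtens := MTens (lquot_pi mtens_rel << x >>).

Lemma mpure_multilinear : multilinear mpure.
Proof.
by move=> x i a u v; congr MTens; apply: lquot_rel (mtens_rel_at x a u v).
Qed.

Lemma mtens_ind (P : mtens -> Prop) :
  (forall x, P (mpure x)) -> (forall a z, P z -> P (a *: z)) ->
  (forall y z, P y -> P z -> P (y + z)) -> P 0 -> forall z, P z.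
Proof.
move=> hp hZ hD h0 [z]; rewrite -[z]lquot_reprK -[lquot_repr z]freeg_sumE.
rewrite (lin_sum (@lquot_pi_linear _ _ _)) (lin_sum mkP); set D := lquot_repr z.
elim/big_ind: _ => // x _.
suff -> : << coeff x D *g x >> = coeff x D *: << x >> :> {freeg _ / k}.
  by rewrite (linZ (@lquot_pi_linear _ _ _)) (linZ mkP); apply: hZ; apply: hp.
apply/eqP/freeg_eqP => y.
by rewrite coeffZ !coeffU mul1r.
Qed.

Section Lift.
Variables (P : lmodType k).
Implicit Types (f g : (forall i, V i) -> P).

(* The linear map induced by f; meaningful only when f is multilinear. *)
Definition mlift f (z : mtens) : P :=
  fglift (f : {classic forall i, V i} -> P) (lquot_repr (mtens_val z)).

Lemma mlift_lin2 f g a z :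
  mlift (fun x => a *: f x + g x) z = a *: mlift f z + mlift g z.
Proof. exact: fglift_lin2. Qed.

Lemma eq_mlift f g : f =1 g -> mlift f =1 mlift g.
Proof. by move=> e z; congr mlift; apply/funext. Qed.

Variable f : (forall i, V i) -> P.
Hypothesis mf : multilinear f.

Let kills r : mtens_rel r ->
  fglift (f : {classic forall i, V i} -> P) r = 0.
Proof.
have hL := fglift_linear (f : {classic forall i, V i} -> P).
case=> x i a u v; rewrite (linD hL) -scaleN1r (linZ hL) (linD hL) (linZ hL);
  rewrite !liftU !scale1r /= scaleN1r; apply/eqP; rewrite subr_eq0.
by rewrite (mf x).
Qed.

Lemma mlift_linear : linear (mlift f).
Proof.
move=> a x y; rewrite /mlift valP.
exact: (lquot_lift_linear (fglift_linear _) kills).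
Qed.

Lemma mliftE x : mlift f (mpure x) = f x.
Proof.
rewrite /mlift /mpure lquot_liftE; [|exact: fglift_linear|exact: kills].
by rewrite liftU scale1r.
Qed.

End Lift.

Lemma mtens_ext (P : lmodType k) (f g : mtens -> P) : linear f -> linear g ->
  (forall x, f (mpure x) = g (mpure x)) -> f =1 g.
Proof.
move=> lf lg e; elim/mtens_ind => // [a x ex|x y ex ey|].
- by rewrite linZ // ex -linZ.
- by rewrite linD // ex ey -linD.
- by rewrite (lin0 lf) (lin0 lg).
Qed.

End MTensor.

Section Functionals.
Variables (k : fieldType) (V : lmodType k).

(* Needed for 1 != 0 in tensor products of algebras. *)
Lemma ex_functional (e : V) : e <> 0 -> exists f : V -> k^o, linear f /\ f e = 1.
Proof.
move=> e0.
pose lc (S : set V) := forall a x y, S x -> S y -> S (a *: x + y).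
have [|M [[lM Me] maxM]] := @Zorn_bigcup V (fun S => lc S /\ ~ S e).
  move=> F FP tot; split=> [a x y [S FS Sx] [S' FS' S'y]|[S FS]]; last first.
    by apply: (FP _ FS).2.
  have [SS'|S'S] := tot _ _ FS FS'.
    by exists S' => //; apply: (FP _ FS').1 => //; apply: SS'.
  by exists S => //; apply: (FP _ FS).1 => //; apply: S'S.
have M0 : M 0.
  apply: contrapT => nM0; apply: (maxM [set 0]%classic).
    split=> [x Mx|/(_ 0 erefl) //]; case: nM0.
    by rewrite -[0](addNr x) -scaleN1r; apply: lM.
  split=> [a x y -> ->|/esym/esym //]; by rewrite scaler0 addr0.
have MZ a x : M x -> M (a *: x) by move=> Mx; rewrite -[_ *: _]addr0; apply: lM.
have MB x y : M x -> M y -> M (x - y).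
  by move=> Mx My; rewrite addrC -scaleN1r; apply: lM.
have hc x : exists c, M (x - c *: e).
  apply: contrapT => /forallNP nx.
  pose B := [set y : V | exists a m, M m /\ y = m + a *: x]%classic.
  have MB' : (M `<` B)%classic.
    split=> [y My|sBM]; first by exists 0, y; rewrite scale0r addr0.
    apply: (nx 0); rewrite scale0r subr0; apply: sBM.
    by exists 1, 0; rewrite scale1r add0r.
  apply: (maxM _ MB'); split=> [a _ _ [b [m [Mm ->]]] [c [m' [Mm' ->]]]|].
    exists (a * b + c), (a *: m + m'); split; first exact: lM.
    by rewrite scalerDr scalerDl scalerA addrACA.
  case=> a [m [Mm em]]; have [a0|a0] := eqVneq a 0.
    by apply: Me; rewrite em a0 scale0r addr0.
  apply: (nx a^-1); rewrite em scalerDr scalerA mulVf // scale1r opprD.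
  by rewrite addrCA subrr addr0 -scaleN1r; apply/MZ/MZ.
have uc x c c' : M (x - c *: e) -> M (x - c' *: e) -> c = c'.
  move=> h h'; apply/eqP; rewrite -subr_eq0; apply/eqP/eqP/negPn/negP => nz.
  apply: Me; rewrite -[e]scale1r -(mulVf nz) -scalerA; apply: MZ.
  by have := MB _ _ h' h; rewrite opprB [x - _]addrC addrACA subrr addr0 addrC -scalerBl.
have {}hc x : {c | M (x - c *: e)} by apply/cid/hc.
exists (fun x => sval (hc x)); split.
  move=> a x y; apply: (uc _ _ _ (svalP (hc _))).
  have := lM a _ _ (svalP (hc x)) (svalP (hc y)).
  by rewrite scalerBr scalerDl -scalerA addrACA opprD.
by apply: (uc e _ _ (svalP (hc _))); rewrite scale1r subrr.
Qed.

End Functionals.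

Section TensorMaps.
Variable k : fieldType.

Section TMap.
Variables (V V' W W' : lmodType k) (f : {linear V -> V'}) (g : {linear W -> W'}).

Definition tmap : tens V W -> tens V' W' :=
  tlift (fun v w => tpure (f v) (g w)).

Let bil : bilin (fun v w => tpure (f v) (g w)).
Proof.
split=> [w a v v'|v a w w'] /=; rewrite linearP.
  exact: (tpure_bilin _ _).1.
exact: (tpure_bilin _ _).2.
Qed.

HB.instance Definition _ :=
  GRing.isLinear.Build k (tens V W) (tens V' W') _ tmap (tlift_linear bil).

Lemma tmapE v w : tmap (tpure v w) = tpure (f v) (g w).
Proof. exact: (tliftE bil). Qed.

End TMap.

Section TSwap.
Variables V W : lmodType k.

Definition tswap : tens V W -> tens W V := tlift (fun v w => tpure w v).

Let bil : bilin (fun (v : V) (w : W) => tpure w v).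
Proof.
split=> [w a v v'|v a w w'] /=; first exact: (tpure_bilin _ _).2.
exact: (tpure_bilin _ _).1.
Qed.

HB.instance Definition _ :=
  GRing.isLinear.Build k (tens V W) (tens W V) _ tswap (tlift_linear bil).

Lemma tswapE v w : tswap (tpure v w) = tpure w v.
Proof. exact: (tliftE bil). Qed.

End TSwap.

Section TAssoc.
Variables U V W : lmodType k.

Definition tassoc : tens (tens U V) W -> tens U (tens V W) :=
  tlift (fun z w => tlift (fun u v => tpure u (tpure v w)) z).

Definition tassocV : tens U (tens V W) -> tens (tens U V) W :=
  tlift (fun u z => tlift (fun v w => tpure (tpure u v) w) z).

Let bil1 (w : W) : bilin (fun (u : U) (v : V) => tpure u (tpure v w)).
Proof.
split=> [v a u u'|u a v v'] /=; first exact: (tpure_bilin _ _).1.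
by rewrite (tpure_bilin _ _).1 (tpure_bilin _ _).2.
Qed.

Let bil2 : bilin (fun z (w : W) => tlift (fun (u : U) (v : V) => tpure u (tpure v w)) z).
Proof.
split=> [w|z a w w'] /=; first exact: tlift_linear (bil1 w).
rewrite -tlift_lin2; apply: eq_tlift => u v.
by rewrite (tpure_bilin _ _).2 (tpure_bilin _ _).2.
Qed.

HB.instance Definition _ :=
  GRing.isLinear.Build k (tens (tens U V) W) (tens U (tens V W)) _ tassoc
    (tlift_linear bil2).

Lemma tassocE u v w : tassoc (tpure (tpure u v) w) = tpure u (tpure v w).
Proof. by rewrite /tassoc (tliftE bil2) (tliftE (bil1 w)). Qed.

Let bil1' (u : U) : bilin (fun (v : V) (w : W) => tpure (tpure u v) w).
Proof.
split=> [w a v v'|v a w w'] /=; last exact: (tpure_bilin _ _).2.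
by rewrite (tpure_bilin _ _).2 (tpure_bilin _ _).1.
Qed.

Let bil2' : bilin (fun (u : U) z => tlift (fun (v : V) (w : W) => tpure (tpure u v) w) z).
Proof.
split=> [z a u u'|u] /=; last exact: tlift_linear (bil1' u).
rewrite -tlift_lin2; apply: eq_tlift => v w.
by rewrite (tpure_bilin _ _).1 (tpure_bilin _ _).1.
Qed.

HB.instance Definition _ :=
  GRing.isLinear.Build k (tens U (tens V W)) (tens (tens U V) W) _ tassocV
    (tlift_linear bil2').

Lemma tassocVE u v w : tassocV (tpure u (tpure v w)) = tpure (tpure u v) w.
Proof. by rewrite /tassocV (tliftE bil2') (tliftE (bil1' u)). Qed.

Lemma tassocK : cancel tassoc tassocV.
Proof.
elim/tens_ind => [z w|x y ex ey]; last by rewrite !linearD /= ex ey.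
elim/tens_ind: z => [u v|x y ex ey]; first by rewrite tassocE tassocVE.
by rewrite (linD ((tpure_bilin _ _).1 w)) !linearD /= ex ey.
Qed.

Lemma tassocVK : cancel tassocV tassoc.
Proof.
elim/tens_ind => [u z|x y ex ey]; last by rewrite !linearD /= ex ey.
elim/tens_ind: z => [v w|x y ex ey]; first by rewrite tassocVE tassocE.
by rewrite (linD ((tpure_bilin _ _).2 u)) !linearD /= ex ey.
Qed.

End TAssoc.

Section TMap2.
Variables (A B X Y X' Y' : lmodType k).
Variables (b : A -> X -> X') (c : B -> Y -> Y').

Definition tmap2 (h : tens A B) (z : tens X Y) : tens X' Y' :=
  tlift (fun a a' => tlift (fun x y => tpure (b a x) (c a' y)) z) h.

Hypotheses (bb : bilin b) (bc : bilin c).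

Let bil1 a a' : bilin (fun x y => tpure (b a x) (c a' y)).
Proof.
split=> [y d x x'|x d y y'] /=.
  by rewrite (bb.2 a) (tpure_bilin _ _).1.
by rewrite (bc.2 a') (tpure_bilin _ _).2.
Qed.

Let bil2 z : bilin (fun a a' => tlift (fun x y => tpure (b a x) (c a' y)) z).
Proof.
split=> [y d x x'|x d y y'] /=; rewrite -tlift_lin2; apply: eq_tlift => u v.
  by rewrite (bb.1 u) (tpure_bilin _ _).1.
by rewrite (bc.1 v) (tpure_bilin _ _).2.
Qed.

Lemma tmap2_bilin : bilin tmap2.
Proof.
split=> [z|h d z z'] /=; first exact: tlift_linear (bil2 z).
rewrite -tlift_lin2; apply: eq_tlift => u v.
by rewrite (tlift_linear (bil1 u v)).
Qed.

Lemma tmap2E a a' x y :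
  tmap2 (tpure a a') (tpure x y) = tpure (b a x) (c a' y).
Proof. by rewrite /tmap2 (tliftE (bil2 _)) (tliftE (bil1 _ _)). Qed.

End TMap2.
End TensorMaps.

Section MTensorMaps.
Variables (k : fieldType) (I : finType).

Lemma dfwith_map (V W : I -> Type) (f : forall i, V i -> W i)
    (x : forall i, V i) i (u : V i) :
  (fun j => f j (dfwith x u j)) = dfwith (fun j => f j (x j)) (f i u).
Proof.
apply: functional_extensionality_dep => j; have [<-|ne] := eqVneq i j.
  by rewrite !dfwith_in.
by rewrite !dfwith_out.
Qed.

Lemma dfwith_id (V : I -> Type) (x : forall i, V i) i : dfwith x (x i) = x.
Proof.
apply: functional_extensionality_dep => j; have [<-|ne] := eqVneq i j.
  by rewrite dfwith_in.
by rewrite dfwith_out.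
Qed.

Lemma dfwith_dfwith (V : I -> Type) (x : forall i, V i) i (u v : V i) :
  dfwith (dfwith x u) v = dfwith x v.
Proof.
apply: functional_extensionality_dep => j; have [<-|ne] := eqVneq i j.
  by rewrite !dfwith_in.
by rewrite !dfwith_out.
Qed.

Lemma dfwithC (V : I -> Type) (x : forall i, V i) i j (u : V i) (v : V j) :
  i != j -> dfwith (dfwith x u) v = dfwith (dfwith x v) u.
Proof.
move=> ij; apply: functional_extensionality_dep => l.
have [<-|ne] := eqVneq j l.
  by rewrite dfwith_in dfwith_out // dfwith_in.
have [<-|ne'] := eqVneq i l; last by rewrite !dfwith_out.
by rewrite [RHS]dfwith_in dfwith_out ?dfwith_in 1?eq_sym.
Qed.

Section MMap.
Variables (V W : I -> lmodType k) (f : forall i, {linear V i -> W i}).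

Definition mmap : mtens V -> mtens W := mlift (fun x => mpure (fun i => f i (x i))).

Let mul : multilinear (fun x => mpure (fun i => f i (x i))).
Proof. by move=> x i a u v; rewrite !(dfwith_map f) linearP (mpure_multilinear _). Qed.

HB.instance Definition _ :=
  GRing.isLinear.Build k (mtens V) (mtens W) _ mmap (mlift_linear mul).

Lemma mmapE x : mmap (mpure x) = mpure (fun i => f i (x i)).
Proof. exact: (mliftE mul). Qed.

End MMap.

Section MMap2.
Variables (A X Y : I -> lmodType k) (b : forall i : I, A i -> X i -> Y i).

Arguments b : clear implicits.

Definition mmap2 (h : mtens A) (z : mtens X) : mtens Y :=
  mlift (fun a => mlift (fun x => mpure (fun i => b i (a i) (x i))) z) h.

Hypothesis bb : forall i, bilin (b i).

Let mul1 a : multilinear (fun x => mpure (fun i => b i (a i) (x i))).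
Proof.
move=> x i d u v; rewrite !(dfwith_map (fun i => b i (a i))).
by rewrite (bb i).2 (mpure_multilinear _).
Qed.

Let mul2 z : multilinear (fun a => mlift (fun x => mpure (fun i => b i (a i) (x i))) z).
Proof.
move=> a i d u v; rewrite -mlift_lin2; apply: eq_mlift => x.
by rewrite !(dfwith_map (fun i a => b i a (x i))) (bb i).1 (mpure_multilinear _).
Qed.

Lemma mmap2_bilin : bilin mmap2.
Proof.
split=> [z|h d z z'] /=; first exact: mlift_linear (mul2 z).
rewrite -mlift_lin2; apply: eq_mlift => a.
by rewrite (mlift_linear (mul1 a)).
Qed.

Lemma mmap2E a x : mmap2 (mpure a) (mpure x) = mpure (fun i => b i (a i) (x i)).
Proof. by rewrite /mmap2 (mliftE (mul2 _)) (mliftE (mul1 _)). Qed.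

End MMap2.

End MTensorMaps.

Section TensorAlgebra.
Variables (k : fieldType) (A B : algType k).

Lemma mulr_bilin (C : algType k) : bilin ( *%R : C -> C -> C).
Proof.
split=> [y a x x'|x a y y'] /=; first by rewrite mulrDl scalerAl.
by rewrite mulrDr scalerAr.
Qed.

Definition tmul : tens A B -> tens A B -> tens A B := tmap2 *%R *%R.

Let bil : bilin tmul := tmap2_bilin (mulr_bilin A) (mulr_bilin B).

Lemma tmulE a b a' b' :
  tmul (tpure a b) (tpure a' b') = tpure (a * a') (b * b').
Proof. exact: tmap2E (mulr_bilin A) (mulr_bilin B) a b a' b'. Qed.

Let mulDl : left_distributive tmul +%R.
Proof. by move=> x y z; rewrite (linD (bil.1 z)). Qed.

Let mulDr : right_distributive tmul +%R.
Proof. by move=> x y z; rewrite (linD (bil.2 x)). Qed.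

Let mulA : associative tmul.
Proof.
elim/tens_ind => [a b y z|x x' ex ex' y z]; last by rewrite !mulDl ex ex'.
elim/tens_ind: y => [c d|y y' ey ey']; last first.
  by rewrite mulDr !mulDl mulDr ey ey'.
elim/tens_ind: z => [e f|z z' ez ez']; last by rewrite !mulDr ez ez'.
by rewrite !tmulE !mulrA.
Qed.

Let mul1 : left_id (tpure 1 1) tmul.
Proof.
by elim/tens_ind => [a b|x y ex ey]; rewrite ?tmulE ?mul1r // mulDr ex ey.
Qed.

Let mulI : right_id (tpure 1 1) tmul.
Proof.
by elim/tens_ind => [a b|x y ex ey]; rewrite ?tmulE ?mulr1 // mulDl ex ey.
Qed.

Let one_neq0 : tpure (1 : A) (1 : B) != 0.
Proof.
have [f [lf f1]] : exists f : A -> k^o, linear f /\ f 1 = 1.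
  by apply: ex_functional; apply/eqP/oner_neq0.
have [g [lg g1]] : exists g : B -> k^o, linear g /\ g 1 = 1.
  by apply: ex_functional; apply/eqP/oner_neq0.
have bfg : bilin (fun a b => (f a : k^o) *: g b).
  split=> [b c x y|a c x y] /=; first by rewrite lf scalerDl scalerA.
  by rewrite lg scalerDr !scalerA mulrC.
apply/eqP => e; have := tliftE bfg 1 1.
rewrite e (lin0 (tlift_linear bfg)) f1 g1 scale1r => /eqP.
by rewrite eq_sym oner_eq0.
Qed.

HB.instance Definition _ := GRing.Zmodule_isNzRing.Build (tens A B)
  mulA mul1 mulI mulDl mulDr one_neq0.

Let scaleAl (a : k) (x y : tens A B) : a *: (x * y) = a *: x * y.
Proof. exact: esym (linZ (bil.1 y) a x). Qed.

Let scaleAr (a : k) (x y : tens A B) : a *: (x * y) = x * (a *: y).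
Proof. exact: esym (linZ (bil.2 x) a y). Qed.

HB.instance Definition _ := GRing.Lmodule_isLalgebra.Build k (tens A B) scaleAl.
HB.instance Definition _ := GRing.Lalgebra_isAlgebra.Build k (tens A B) scaleAr.

Lemma tpureM a b a' b' :
  tpure a b * tpure a' b' = tpure (a * a') (b * b') :> tens A B.
Proof. exact: tmulE. Qed.

Lemma tpure1 : tpure 1 1 = 1 :> tens A B.
Proof. by []. Qed.

End TensorAlgebra.

Section MTensorAlgebra.
Variables (k : fieldType) (I : finType) (H : I -> algType k).

Definition mmul : mtens H -> mtens H -> mtens H :=
  mmap2 (fun i => *%R : H i -> H i -> H i).

Let bb i : bilin ( *%R : H i -> H i -> H i) := mulr_bilin (H i).
Let bil : bilin mmul := mmap2_bilin bb.

Lemma mmulE x y : mmul (mpure x) (mpure y) = mpure (fun i => x i * y i).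
Proof. exact: (mmap2E bb). Qed.

Let mulDl : left_distributive mmul +%R.
Proof. by move=> x y z; rewrite (linD (bil.1 z)). Qed.

Let mulDr : right_distributive mmul +%R.
Proof. by move=> x y z; rewrite (linD (bil.2 x)). Qed.

Let mulZl a x y : mmul (a *: x) y = a *: mmul x y.
Proof. exact: linZ (bil.1 y) a x. Qed.

Let mulZr a x y : mmul x (a *: y) = a *: mmul x y.
Proof. exact: linZ (bil.2 x) a y. Qed.

Let mul0l x : mmul 0 x = 0.
Proof. exact: lin0 (bil.1 x). Qed.

Let mul0r x : mmul x 0 = 0.
Proof. exact: lin0 (bil.2 x). Qed.

Let mulA : associative mmul.
Proof.
elim/mtens_ind => [x y z|a x ex y z|x x' ex ex' y z|y z].
- elim/mtens_ind: y => [y|a y ey|y y' ey ey'|].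
  + elim/mtens_ind: z => [z|a z ez|z z' ez ez'|].
    * by rewrite !mmulE; congr mpure; apply: functional_extensionality_dep => i;
        rewrite mulrA.
    * by rewrite !mulZr ez.
    * by rewrite !mulDr ez ez'.
    * by rewrite !mul0r.
  + by rewrite mulZl !mulZr mulZl ey.
  + by rewrite mulDr !mulDl mulDr ey ey'.
  + by rewrite mul0l !mul0r mul0l.
- by rewrite !mulZl ex.
- by rewrite !mulDl ex ex'.
- by rewrite !mul0l.
Qed.

Let mul1 : left_id (mpure (fun=> 1)) mmul.
Proof.
elim/mtens_ind => [x|a x ex|x y ex ey|].
- rewrite mmulE; congr mpure; apply: functional_extensionality_dep => i.
  by rewrite mul1r.
- by rewrite mulZr ex.
- by rewrite mulDr ex ey.
- exact: mul0r.
Qed.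

Let mulI : right_id (mpure (fun=> 1)) mmul.
Proof.
elim/mtens_ind => [x|a x ex|x y ex ey|].
- rewrite mmulE; congr mpure; apply: functional_extensionality_dep => i.
  by rewrite mulr1.
- by rewrite mulZl ex.
- by rewrite mulDl ex ey.
- exact: mul0l.
Qed.

Let one_neq0 : mpure (fun i => 1 : H i) != 0.
Proof.
have ex i : exists f : H i -> k^o, linear f /\ f 1 = 1.
  by apply: ex_functional; apply/eqP/oner_neq0.
pose f i := sval (cid (ex i)).
have [lf f1] : (forall i, linear (f i)) /\ (forall i, f i 1 = 1).
  by split=> i; rewrite /f; case: cid => g [].
have mf : multilinear (fun x : forall i, H i => (\prod_i f i (x i) : k^o)).
  move=> x i a u v.
  have e w : \prod_j f j (dfwith x w j) =
      f i w * \prod_(j | j != i) f j (x j).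
    rewrite (bigD1 i) //= dfwith_in; congr (_ * _).
    by apply: eq_bigr => j ji; rewrite dfwith_out // eq_sym.
  by rewrite !e lf mulrDl -mulrA.
apply/eqP => e; have := mliftE mf (fun=> 1).
rewrite e (lin0 (mlift_linear mf)) big1 // => /eqP.
by rewrite eq_sym oner_eq0.
Qed.

HB.instance Definition _ := GRing.Zmodule_isNzRing.Build (mtens H)
  mulA mul1 mulI mulDl mulDr one_neq0.

Let scaleAl (a : k) (x y : mtens H) : a *: (x * y) = a *: x * y.
Proof. exact: esym (mulZl a x y). Qed.

Let scaleAr (a : k) (x y : mtens H) : a *: (x * y) = x * (a *: y).
Proof. exact: esym (mulZr a x y). Qed.

HB.instance Definition _ := GRing.Lmodule_isLalgebra.Build k (mtens H) scaleAl.
HB.instance Definition _ := GRing.Lalgebra_isAlgebra.Build k (mtens H) scaleAr.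

Lemma mpureM x y : mpure x * mpure y = mpure (fun i => x i * y i) :> mtens H.
Proof. exact: mmulE. Qed.

Lemma mpure1 : mpure (fun=> 1) = 1 :> mtens H.
Proof. by []. Qed.

End MTensorAlgebra.


Section Shuffle.
Variables (k : fieldType) (I : finType) (V W : I -> lmodType k).

Section Multilift.
Variables (P : lmodType k) (g : (forall i, V i) -> (forall i, W i) -> P).

Fixpoint slift (r : seq I) (z : forall i, tens (V i) (W i)) v w : P :=
  if r is i :: r' then
    tlift (fun a b => slift r' z (dfwith v a) (dfwith w b)) (z i)
  else g v w.

Hypothesis bg : forall v w i,
  bilin (fun (a : V i) (b : W i) => g (dfwith v a) (dfwith w b)).

Lemma slift_bilin r z v w i : i \notin r ->
  bilin (fun (a : V i) (b : W i) => slift r z (dfwith v a) (dfwith w b)).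
Proof.
elim: r v w => [|j r IH] v w; first by move=> _; apply: bg.
rewrite inE negb_or => /andP[ij ir].
have e (a : V i) (b : W i) : slift (j :: r) z (dfwith v a) (dfwith w b) =
    tlift (fun c d => slift r z (dfwith (dfwith v c) a) (dfwith (dfwith w d) b))
      (z j).
  by apply: eq_tlift => c d; rewrite (dfwithC v a c ij) (dfwithC w b d ij).
split=> [b x a a'|a x b b']; rewrite !e -tlift_lin2; apply: eq_tlift => c d.
  by rewrite ((IH _ _ ir).1 b).
by rewrite ((IH _ _ ir).2 a).
Qed.

Lemma slift_out r z v w i (u : tens (V i) (W i)) : i \notin r ->
  slift r (dfwith z u) v w = slift r z v w.
Proof.
elim: r v w => [|j r IH] v w //=; rewrite inE negb_or => /andP[ij ir].
by rewrite dfwith_out //; apply: eq_tlift => c d; apply: IH.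
Qed.

Lemma slift_linear r z v w i : uniq r -> i \in r ->
  linear (fun u : tens (V i) (W i) => slift r (dfwith z u) v w).
Proof.
elim: r v w => [|j r IH] v w //= /andP[jr ur]; rewrite inE.
have [ij _|ij /= ir] := eqVneq i j.
  subst j => a x y; rewrite !dfwith_in.
  have e (u : tens (V i) (W i)) : tlift (fun c d =>
      slift r (dfwith z u) (dfwith v c) (dfwith w d)) u =
      tlift (fun c d => slift r z (dfwith v c) (dfwith w d)) u.
    by apply: eq_tlift => c d; apply: slift_out.
  by rewrite !e (tlift_linear (slift_bilin z v w jr)).
move=> a x y; rewrite !(dfwith_out _ _ ij) -tlift_lin2.
by apply: eq_tlift => c d; rewrite (IH _ _ ur ir).
Qed.

Lemma slift_pure r (a : forall i, V i) (b : forall i, W i) v w : uniq r ->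
  slift r (fun i => tpure (a i) (b i)) v w =
  g (fun i => if i \in r then a i else v i)
    (fun i => if i \in r then b i else w i).
Proof.
elim: r v w => [|j r IH] v w //= /andP[jr ur].
rewrite (tliftE (slift_bilin _ _ _ jr)) IH //.
congr g; apply: functional_extensionality_dep => i; rewrite inE;
  have [->|ij] := eqVneq i j; rewrite ?(negPf jr) ?dfwith_in //;
  by rewrite dfwith_out // eq_sym.
Qed.

End Multilift.

Let g (v : forall i, V i) (w : forall i, W i) := tpure (mpure v) (mpure w).

Let bg v w i : bilin (fun (a : V i) (b : W i) => g (dfwith v a) (dfwith w b)).
Proof.
split=> [b x a a'|a x b b'] /=; rewrite /g (mpure_multilinear _).
  by rewrite (tpure_bilin _ _).1.
by rewrite (tpure_bilin _ _).2.
Qed.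

(* The canonical map whose value on pure tensors is given by mshuffleE; slift
   extends v, w |-> tpure (mpure v) (mpure w) one coordinate at a time. *)
Definition mshuffle : mtens (fun i => tens (V i) (W i)) ->
    tens (mtens V) (mtens W) :=
  mlift (fun z => slift (fun v w => tpure (mpure v) (mpure w))
                   (enum I) z (fun=> 0) (fun=> 0)).

Let mul : multilinear (fun z => slift g (enum I) z (fun=> 0) (fun=> 0)).
Proof.
by move=> z i; apply: slift_linear; rewrite ?enum_uniq ?mem_enum.
Qed.

Lemma mshuffle_linear : linear mshuffle.
Proof. exact: mlift_linear mul. Qed.

HB.instance Definition _ := GRing.isLinear.Build k
  (mtens (fun i => tens (V i) (W i))) (tens (mtens V) (mtens W)) _ mshuffle
  mshuffle_linear.

Lemma mshuffleE v w :
  mshuffle (mpure (fun i => tpure (v i) (w i))) = tpure (mpure v) (mpure w).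
Proof.
rewrite /mshuffle (mliftE mul) slift_pure ?enum_uniq //.
by congr (tpure (mpure _) (mpure _));
  apply: functional_extensionality_dep => i; rewrite mem_enum.
Qed.

Lemma mtens_tens_ext (P : lmodType k)
    (f h : mtens (fun i => tens (V i) (W i)) -> P) : linear f -> linear h ->
  (forall v w, f (mpure (fun i => tpure (v i) (w i))) =
               h (mpure (fun i => tpure (v i) (w i)))) -> f =1 h.
Proof.
move=> lf lh e; apply: mtens_ext => // z.
have: forall i, i \notin enum I -> exists v w, z i = tpure v w.
  by move=> i; rewrite mem_enum.
elim: (enum I) z => [|j r IH] z hz.
  have hz' i : {vw : V i * W i | z i = tpure vw.1 vw.2}.
    by apply: cid; have [v [w zE]] := hz i isT; exists (v, w).
  have -> : z = fun i => tpure (sval (hz' i)).1 (sval (hz' i)).2.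
    by apply: functional_extensionality_dep => i; apply: svalP (hz' i).
  exact: e.
rewrite -(dfwith_id z j); elim/tens_ind: (z j) => [v w|x y ex ey].
  apply: IH => i ir; have [ij|ij] := eqVneq j i.
    by subst i; exists v, w; rewrite dfwith_in.
  by rewrite dfwith_out //; apply: hz; rewrite inE negb_or eq_sym ij.
have mD : mpure (dfwith z (x + y)) = mpure (dfwith z x) + mpure (dfwith z y).
  exact: linD (mpure_multilinear z (i := j)) x y.
by rewrite mD (linD lf) (linD lh) ex ey.
Qed.

End Shuffle.

Section ShuffleAlgebra.
Variables (k : fieldType) (I : finType) (A B : I -> algType k).

Lemma mshuffleM (x y : mtens (fun i => tens (A i) (B i))) :
  mshuffle (x * y) = mshuffle x * mshuffle y :> tens (mtens A) (mtens B).
Proof.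
move: x; apply: mtens_tens_ext => [a x x'|a x x'|a b].
- by rewrite ((mulr_bilin _).1 y) mshuffle_linear.
- by rewrite mshuffle_linear ((mulr_bilin _).1 (mshuffle y)).
move: y; apply: mtens_tens_ext => [c x x'|c x x'|c d].
- by rewrite ((mulr_bilin _).2 (mpure _)) mshuffle_linear.
- by rewrite mshuffle_linear ((mulr_bilin _).2 (mshuffle (mpure _))).
rewrite mpureM !mshuffleE tpureM !mpureM -mshuffleE; congr (mshuffle (mpure _)).
by apply: functional_extensionality_dep => i; rewrite tpureM.
Qed.

Lemma mshuffle1 : mshuffle 1 = 1 :> tens (mtens A) (mtens B).
Proof. by rewrite -[1 in LHS]mpure1 -[RHS]tpure1 -!mpure1 -mshuffleE. Qed.

End ShuffleAlgebra.

(* R_12, R_13, R_23 in A (x) A (x) A, bracketed to the left. *)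
Section Legs.
Variables (k : fieldType) (A : algType k).
Implicit Types r : tens A A.

Definition leg12 r : tens (tens A A) A :=
  tlift (fun s t => tpure (tpure s t) 1) r.
Definition leg13 r : tens (tens A A) A :=
  tlift (fun s t => tpure (tpure s 1) t) r.
Definition leg23 r : tens (tens A A) A :=
  tlift (fun s t => tpure (tpure 1 s) t) r.

End Legs.

HB.mixin Record Algebra_isHopf (k : fieldType) A of GRing.Algebra k A := {
  comul : {lrmorphism A -> tens A A};
  counit : {lrmorphism A -> k^o};
  antipode : {linear A -> A};
  antipodeV : A -> A;
  comulA : forall x : A,
    tassoc (tmap comul (idfun : {linear A -> A}) (comul x)) =
    tmap (idfun : {linear A -> A}) comul (comul x);
  counitl : forall x : A, tlift (fun a b : A => counit a *: b) (comul x) = x;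
  counitr : forall x : A, tlift (fun a b : A => counit b *: a) (comul x) = x;
  antipodel : forall x : A,
    tlift (fun a b : A => antipode a * b) (comul x) = (counit x)%:A;
  antipoder : forall x : A,
    tlift (fun a b : A => a * antipode b) (comul x) = (counit x)%:A;
  antipodeK : cancel antipode antipodeV;
  antipodeVK : cancel antipodeV antipode
}.

#[short(type="hopfType")]
HB.structure Definition Hopf (k : fieldType) :=
  {A of GRing.Algebra k A & Algebra_isHopf k A}.

(* id (x) Delta lands in A (x) (A (x) A), whence the tassoc in univR_hexr. *)
HB.mixin Record Hopf_isQuasitriangular (k : fieldType) A of Hopf k A := {
  univR : tens A A;
  univRV : tens A A;
  univR_mulV : univR * univRV = 1;
  univR_Vmul : univRV * univR = 1;
  univR_comul : forall x : A, tswap (comul x) = univR * comul x * univRV;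
  univR_hexl : tmap comul (idfun : {linear A -> A}) univR =
               leg13 univR * leg23 univR;
  univR_hexr : tmap (idfun : {linear A -> A}) comul univR =
               tassoc (leg13 univR * leg12 univR)
}.

#[short(type="qthopfType")]
HB.structure Definition QTHopf (k : fieldType) :=
  {A of Hopf k A & Hopf_isQuasitriangular k A}.

Section MultilinearSum.
Variables (k : fieldType) (I : finType) (V : I -> lmodType k) (P : lmodType k).
Variable f : (forall i, V i) -> P.
Hypothesis mf : multilinear f.
Variables (J : I -> finType) (F : forall i, J i -> V i).
Arguments F : clear implicits.

Let mix (r : seq I) (x z : forall i, V i) i := if i \in r then x i else z i.

Let mix_cons r i x z : i \notin r ->
  mix (i :: r) x z = dfwith (mix r x z) (x i).
Proof.
move=> ir; apply: functional_extensionality_dep => l; rewrite /mix inE.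
have [->|il] := eqVneq l i; first by rewrite dfwith_in.
by rewrite dfwith_out // eq_sym.
Qed.

Let mix_dfwith r i x z u : i \notin r ->
  mix r x (dfwith z u) = dfwith (mix r x z) (u : V i).
Proof.
move=> ir; apply: functional_extensionality_dep => l; rewrite /mix.
have [<-|il] := eqVneq i l; first by rewrite (negPf ir) !dfwith_in.
by rewrite !dfwith_out.
Qed.

Let agree (j0 : {dffun forall i, J i}) (r : seq I) (j : {dffun forall i, J i}) :=
  [forall i, (i \notin r) ==> (j i == j0 i)].

Let expand_seq j0 r z : uniq r ->
  f (mix r (fun i => \sum_j F i j) z) =
  \sum_(j | agree j0 r j) f (mix r (fun i => F i (j i)) z).
Proof.
elim: r z => [|i r IH] z /=.
  move=> _; rewrite (big_pred1 j0) // => j; apply/forallP/eqP => [h|-> i].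
    by apply/ffunP => i; apply/eqP/(implyP (h i)).
  by rewrite eqxx implybT.
case/andP=> ir ur; rewrite mix_cons // (lin_sum (mf _ (i := i))).
rewrite [RHS](partition_big (fun j : {dffun forall i, J i} => j i) predT) //=.
apply: eq_bigr => c _; rewrite -mix_dfwith // (IH _ ur).
pose up (j : {dffun forall i, J i}) (d : J i) : {dffun forall i, J i} :=
  [ffun l => dfwith j d l].
rewrite [RHS](reindex_onto (up^~ c) (up^~ (j0 i))) /=; last first.
  move=> j /andP[_ /eqP <-]; apply/ffunP => l; rewrite !ffunE.
  have [<-|il] := eqVneq i l; first by rewrite dfwith_in.
  by rewrite dfwith_out // ffunE dfwith_out.
apply: eq_big => [j|j _].
  rewrite ffunE dfwith_in eqxx andbT; apply/forallP/andP => [h|[/forallP h /eqP e] l].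
    split; first apply/forallP => l.
      apply/implyP; rewrite inE negb_or => /andP[li lr].
      by rewrite ffunE dfwith_out ?(implyP (h l)) // eq_sym.
    apply/eqP/ffunP => l; rewrite !ffunE.
    have [<-|il] := eqVneq i l.
      by rewrite dfwith_in; apply/esym/eqP/(implyP (h i)).
    by rewrite dfwith_out // ffunE dfwith_out.
  apply/implyP => lr; have [il|il] := eqVneq i l.
    by subst l; rewrite -e !ffunE dfwith_in.
  have := h l; rewrite inE eq_sym (negPf il) (negPf lr) /= ffunE dfwith_out //.
rewrite mix_dfwith // mix_cons // ffunE dfwith_in.
suff -> : mix r (fun l => F l (up j c l)) z = mix r (fun l => F l (j l)) z.
  by [].
apply: functional_extensionality_dep => l; rewrite /mix.
case: ifP => // lr; rewrite ffunE dfwith_out //.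
by apply: contraNneq ir => ->.
Qed.

Lemma multilinear_sum :
  f (fun i => \sum_(j : J i) F i j) =
  \sum_(j : {dffun forall i, J i}) f (fun i => F i (j i)).
Proof.
have mixT x : mix (enum I) x (fun=> 0) = x.
  by apply: functional_extensionality_dep => i; rewrite /mix mem_enum.
case: (pickP (fun _ : {dffun forall i, J i} => true)) => [j0 _|no].
  rewrite -[X in f X]mixT (expand_seq j0) ?enum_uniq //.
  apply: eq_big => [j|j _]; last by rewrite mixT.
  by apply/forallP => i; rewrite mem_enum.
rewrite [RHS]big1 => [|j _]; last by have := no j.
have [i Ji] : exists i, forall c : J i, False.
  apply: contrapT => /forallNP h.
  have {}h i : {c : J i | True}.
    apply: cid; apply: contrapT => /forallNP h'.
    by apply: (h i) => c; apply: (h' c).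
  by have := no [ffun i => sval (h i)].
set x := fun i => _; rewrite -(dfwith_id x i).
have -> : x i = 0 by apply: big1 => c; case: (Ji c).
exact: lin0 (mf x (i := i)).
Qed.

End MultilinearSum.

Section MComul.
Variables (k : fieldType) (I : finType) (H : I -> hopfType k).

(* On pure tensors this is the Sweedler formula, see mcomul_sum. *)
Definition mcomul_map (z : mtens H) : tens (mtens H) (mtens H) :=
  mshuffle (mmap (fun i => comul : {linear H i -> tens (H i) (H i)}) z).

Let mcomul_linear : linear mcomul_map.
Proof. by move=> a x y; rewrite /mcomul_map !linearP. Qed.

HB.instance Definition _ := GRing.isLinear.Build k
  (mtens H) (tens (mtens H) (mtens H)) _ mcomul_map mcomul_linear.

Lemma mcomulE x : mcomul_map (mpure x) = mshuffle (mpure (fun i => comul (x i))).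
Proof. by rewrite /mcomul_map mmapE. Qed.

Let mcomulM : {morph mcomul_map : x y / x * y}.
Proof.
move=> x y; move: x; apply: mtens_ext => [a x x'|a x x'|x].
- by rewrite ((mulr_bilin _).1 y) mcomul_linear.
- by rewrite mcomul_linear ((mulr_bilin _).1 (mcomul_map y)).
move: y; apply: mtens_ext => [a y y'|a y y'|y].
- by rewrite ((mulr_bilin _).2 (mpure _)) mcomul_linear.
- by rewrite mcomul_linear ((mulr_bilin _).2 (mcomul_map _)).
rewrite mpureM !mcomulE -mshuffleM mpureM; congr (mshuffle (mpure _)).
by apply: functional_extensionality_dep => i; rewrite rmorphM.
Qed.

Let mcomul1 : mcomul_map 1 = 1.
Proof.
rewrite -mpure1 mcomulE -mshuffle1 -mpure1; congr (mshuffle (mpure _)).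
by apply: functional_extensionality_dep => i; rewrite rmorph1.
Qed.

HB.instance Definition _ := GRing.isMonoidMorphism.Build
  (mtens H) (tens (mtens H) (mtens H)) mcomul_map (mcomul1, mcomulM).

Definition mcomul : {lrmorphism mtens H -> tens (mtens H) (mtens H)} :=
  mcomul_map.

Lemma mcomul_sum (x : forall i, H i) (J : I -> finType)
    (x' x'' : forall i, J i -> H i) :
    (forall i, comul (x i) = \sum_(j : J i) tpure (x' i j) (x'' i j)) ->
  mcomul (mpure x) = \sum_(j : {dffun forall i, J i})
    tpure (mpure (fun i => x' i (j i))) (mpure (fun i => x'' i (j i))).
Proof.
move=> xE; rewrite [LHS]mcomulE.
have -> : (fun i => comul (x i)) = fun i => \sum_j tpure (x' i j) (x'' i j).
  by apply: functional_extensionality_dep.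
rewrite (multilinear_sum (@mpure_multilinear _ _ _)) raddf_sum.
by apply: eq_bigr => j _; apply: (mshuffleE (fun i => x' i (j i))).
Qed.

End MComul.
Arguments mcomul {k I} H.

(* Left modules over a k-algebra A, as k-vector spaces with a bilinear action:
   an lmodType A has no k-structure over which to tensor. *)
Record amodule (k : fieldType) (A : algType k) := AModule {
  amod_sort :> lmodType k;
  act : A -> amod_sort -> amod_sort;
  act_bilin : bilin act;
  act1 : forall x, act 1 x = x;
  actM : forall a b x, act (a * b) x = act a (act b x)
}.

Definition amod_iso (k : fieldType) (A : algType k) (X Y : amodule A)
    (f : X -> Y) : Prop :=
  [/\ linear f, bijective f & forall a x, f (act a x) = act a (f x)].
Arguments amod_iso {k A} X Y f.

Section TensorModule.
Variables (k : fieldType) (A B : algType k) (X : amodule A) (Y : amodule B).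

Definition tact : tens A B -> tens X Y -> tens X Y :=
  tmap2 (@act k A X) (@act k B Y).

Let bil : bilin tact := tmap2_bilin (@act_bilin k A X) (@act_bilin k B Y).

Lemma tactE a b x y : tact (tpure a b) (tpure x y) = tpure (act a x) (act b y).
Proof. exact: tmap2E (@act_bilin k A X) (@act_bilin k B Y) a b x y. Qed.

Let tact1 z : tact 1 z = z.
Proof.
elim/tens_ind: z => [x y|x y ex ey]; first by rewrite tactE !act1.
by rewrite (linD (bil.2 1)) ex ey.
Qed.

Let tactM a b z : tact (a * b) z = tact a (tact b z).
Proof.
elim/tens_ind: a => [a a'|a a' ea ea']; last first.
  by rewrite mulrDl (linD (bil.1 z)) (linD (bil.1 _)) ea ea'.
elim/tens_ind: b => [b b'|b b' eb eb']; last first.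
  by rewrite mulrDr !(linD (bil.1 z)) (linD (bil.2 _)) eb eb'.
elim/tens_ind: z => [x y|x y ex ey]; last by rewrite !(linD (bil.2 _)) ex ey.
by rewrite tpureM !tactE !actM.
Qed.

Definition tens_amod : amodule (tens A B) :=
  @AModule k (tens A B) (tens X Y) tact bil tact1 tactM.

End TensorModule.

Section MTensorModule.
Variables (k : fieldType) (I : finType) (H : I -> algType k).
Variable X : forall i, amodule (H i).

Definition mact : mtens H -> mtens X -> mtens X :=
  mmap2 (fun i => @act k (H i) (X i)).

Let bil : bilin mact := mmap2_bilin (fun i => @act_bilin k (H i) (X i)).

Lemma mactE h x : mact (mpure h) (mpure x) = mpure (fun i => act (h i) (x i)).
Proof. exact: (mmap2E (fun i => @act_bilin k (H i) (X i))). Qed.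

Let mact1 z : mact 1 z = z.
Proof.
move: z; apply: mtens_ext => [|//|x]; first exact: bil.2.
rewrite mactE; congr mpure; apply: functional_extensionality_dep => i.
exact: act1.
Qed.

Let mactM a b z : mact (a * b) z = mact a (mact b z).
Proof.
move: z; apply: mtens_ext => [|c x y|z]; first exact: bil.2.
  by rewrite !bil.2.
move: b; apply: mtens_ext => [c x y|c x y|b].
- by rewrite ((mulr_bilin _).2 a) bil.1.
- by rewrite bil.1 bil.2.
move: a; apply: mtens_ext => [c x y|c x y|a].
- by rewrite ((mulr_bilin _).1 (mpure b)) bil.1.
- by rewrite bil.1.
rewrite mpureM !mactE; congr mpure; apply: functional_extensionality_dep => i.
exact: actM.
Qed.

Definition mtens_amod : amodule (mtens H) :=
  @AModule k (mtens H) (mtens X) mact bil mact1 mactM.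

End MTensorModule.

Section Pullback.
Variables (k : fieldType) (A B : algType k) (f : {lrmorphism A -> B}).
Variable X : amodule B.

Let pact a x := @act k B X (f a) x.

Let bil : bilin pact.
Proof.
split=> [x a b b'|b] /=; last exact: (act_bilin X).2.
by rewrite /pact linearP (act_bilin _).1.
Qed.

Let pact1 x : pact 1 x = x.
Proof. by rewrite /pact rmorph1 act1. Qed.

Let pactM a b x : pact (a * b) x = pact a (pact b x).
Proof. by rewrite /pact rmorphM actM. Qed.

Definition amod_pullback : amodule A := @AModule k A X pact bil pact1 pactM.

End Pullback.

Section Braiding.
Variables (k : fieldType) (A : algType k) (r : tens A A) (X Y : amodule A).

(* tau \o (r |>); the explicit formula on pure tensors is braid_mpureE. *)
Definition braid (z : tens X Y) : tens Y X :=
  tswap (act r (z : tens_amod X Y)).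

Let braid_linear : linear braid.
Proof.
by move=> a x y; rewrite /braid ((act_bilin (tens_amod X Y)).2 r) linearP.
Qed.

HB.instance Definition _ :=
  GRing.isLinear.Build k (tens X Y) (tens Y X) _ braid braid_linear.

End Braiding.
Arguments braid {k A} r X Y z.

Lemma braidE (k : fieldType) (A : algType k) (r : tens A A) (X Y : amodule A)
    (J : finType) (s t : J -> A) x y : r = \sum_j tpure (s j) (t j) ->
  braid r X Y (tpure x y) = \sum_j tpure (act (t j) y) (act (s j) x).
Proof.
move=> ->; rewrite /braid (lin_sum ((act_bilin (tens_amod X Y)).1 _)) raddf_sum.
apply: eq_bigr => j _; rewrite -[RHS]tswapE; congr tswap; exact: tactE.
Qed.

Lemma braid_mpureE (k : fieldType) (I : finType) (H : I -> algType k)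
    (J : I -> finType) (s t : forall i, J i -> H i)
    (X Y : forall i, amodule (H i)) (x : forall i, X i) (y : forall i, Y i) :
  braid (\sum_(j : {dffun forall i, J i})
           tpure (mpure (fun i => s i (j i))) (mpure (fun i => t i (j i))))
      (mtens_amod X) (mtens_amod Y) (tpure (mpure x) (mpure y)) =
  \sum_(j : {dffun forall i, J i})
    tpure (mpure (fun i => act (t i (j i)) (y i)))
          (mpure (fun i => act (s i (j i)) (x i))).
Proof.
by rewrite (braidE _ _ erefl); apply: eq_bigr => j _; rewrite -!mactE.
Qed.

(* X (x) Y as an A-module through the coproduct D *)
Definition comul_amod (k : fieldType) (A : algType k)
    (D : {lrmorphism A -> tens A A}) (X Y : amodule A) : amodule A :=
  amod_pullback D (tens_amod X Y).

(* Main.v *)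
(** Regrouping tensor factors is an algebra morphism from the tensor product of
    the H_m (x) H_m to H (x) H, and R is the image of the tensor product of the
    R_m; so R inherits from the R_m invertibility, the relation
    R D(x) = D^op(x) R and, after regrouping triple tensor products, the
    Yang-Baxter equation R12 R13 R23 = R23 R13 R12. The first two give (a).
    For (b), let s12 and s23 be the swaps of adjacent factors: the braidings are
    s12 R12 and s23 R23, and moving all the swaps to the left turns the two
    sides into s12 s23 s12 (R23 R13 R12) and s23 s12 s23 (R12 R13 R23). *)
Require Import Defs.
From HB Require Import structures.
From mathcomp Require Import all_boot all_algebra.
From mathcomp Require Import boolp.

Set Implicit Arguments.
Unset Strict Implicit.
Unset Printing Implicit Defensive.

Import GRing.Theory.
Local Open Scope ring_scope.

(** * Linearity of the three embeddings of A (x) A into A (x) A (x) A *)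

Section Legs.
Variables (k : fieldType) (A : algType k).
Implicit Types (r : tens A A) (a b : A).

Let bil12 : bilinear_for *:%R *:%R
  (fun a b => tpure (tpure a b) 1 : tens (tens A A) A).
Proof.
split=> [b c a a'|a c b b'] /=.
  by rewrite (tpure_bilin _ _).1 (tpure_bilin _ _).1.
by rewrite (tpure_bilin _ _).2 (tpure_bilin _ _).1.
Qed.

Let bil13 : bilinear_for *:%R *:%R
  (fun a b => tpure (tpure a 1) b : tens (tens A A) A).
Proof.
split=> [b c a a'|a c b b'] /=; last by rewrite (tpure_bilin _ _).2.
by rewrite (tpure_bilin _ _).1 (tpure_bilin _ _).1.
Qed.

Let bil23 : bilinear_for *:%R *:%R
  (fun a b => tpure (tpure 1 a) b : tens (tens A A) A).
Proof.
split=> [b c a a'|a c b b'] /=; last by rewrite (tpure_bilin _ _).2.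
by rewrite (tpure_bilin _ _).2 (tpure_bilin _ _).1.
Qed.

Lemma leg12_linear : linear (@leg12 k A).
Proof. exact: tlift_linear bil12. Qed.

Lemma leg13_linear : linear (@leg13 k A).
Proof. exact: tlift_linear bil13. Qed.

Lemma leg23_linear : linear (@leg23 k A).
Proof. exact: tlift_linear bil23. Qed.

Lemma leg12E a b : leg12 (tpure a b) = tpure (tpure a b) 1.
Proof. exact: (tliftE bil12). Qed.

Lemma leg13E a b : leg13 (tpure a b) = tpure (tpure a 1) b.
Proof. exact: (tliftE bil13). Qed.

Lemma leg23E a b : leg23 (tpure a b) = tpure (tpure 1 a) b.
Proof. exact: (tliftE bil23). Qed.

(** With brackets to the left, this embedding gives an outer pure tensor even when [r] is not pure,
    so later arguments need not decompose [r]. *)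
Lemma leg12_tpure r : leg12 r = tpure r 1.
Proof.
elim/tens_ind: r => [a b|x y ex ey]; first exact: leg12E.
by rewrite (linD leg12_linear) ex ey (linD ((tpure_bilin _ _).1 1)).
Qed.

HB.instance Definition _ := GRing.isLinear.Build k
  (tens A A) (tens (tens A A) A) _ (@leg12 k A) leg12_linear.
HB.instance Definition _ := GRing.isLinear.Build k
  (tens A A) (tens (tens A A) A) _ (@leg13 k A) leg13_linear.
HB.instance Definition _ := GRing.isLinear.Build k
  (tens A A) (tens (tens A A) A) _ (@leg23 k A) leg23_linear.

End Legs.

(** * Multiplicativity of maps between tensor products of algebras *)

Section TensorMorphisms.
Variable k : fieldType.

(** Multiplicativity is a hypothesis on linear maps because [tswap] and [mshuffle] are bundled only
    as linear maps. *)
Lemma tmapM (A B A' B' : algType k) (f : {linear A -> A'})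
    (g : {linear B -> B'}) :
  {morph f : x y / x * y} -> {morph g : x y / x * y} ->
  forall x y : tens A B, tmap f g (x * y) = tmap f g x * tmap f g y.
Proof.
move=> fM gM x y.
elim/tens_ind: x => [a b|x x' ex ex']; last first.
  by rewrite mulrDl !linearD /= mulrDl ex ex'.
elim/tens_ind: y => [c d|y y' ey ey']; last first.
  by rewrite mulrDr !linearD /= mulrDr ey ey'.
by rewrite tpureM !tmapE tpureM fM gM.
Qed.

Lemma tswapM (A B : algType k) (x y : tens A B) :
  tswap (x * y) = tswap x * tswap y.
Proof.
elim/tens_ind: x => [a b|x x' ex ex']; last first.
  by rewrite mulrDl !linearD /= mulrDl ex ex'.
elim/tens_ind: y => [c d|y y' ey ey']; last first.
  by rewrite mulrDr !linearD /= mulrDr ey ey'.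
by rewrite tpureM !tswapE tpureM.
Qed.

Lemma tswapK (V W : lmodType k) : cancel (@tswap k V W) (@tswap k W V).
Proof.
elim/tens_ind => [v w|x y ex ey]; first by rewrite !tswapE.
by rewrite !linearD /= ex ey.
Qed.

End TensorMorphisms.

(** * The Yang-Baxter equation in one quasitriangular Hopf algebra *)

Lemma univR_comulC (k : fieldType) (A : qthopfType k) (x : A) :
  (univR : tens A A) * comul x = tswap (comul x) * univR :> tens A A.
Proof.
pose R : tens A A := univR; pose R' : tens A A := univRV.
have R'R : R' * R = 1 := univR_Vmul.
have RE : tswap (comul x : tens A A) = R * comul x * R' := univR_comul x.
by rewrite RE -[RHS]mulrA [in RHS]R'R mulr1.
Qed.

(** R13 R23 is the coproduct applied to the first leg of R. Moving R12 across it replaces the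
    coproduct by its opposite, that is, swaps the first two factors, and this swap turns R13 R23
    into R23 R13. *)
Lemma univR_yang_baxter (k : fieldType) (A : qthopfType k) :
  let R : tens A A := univR in
  leg12 R * leg13 R * leg23 R = leg23 R * leg13 R * leg12 R.
Proof.
set R : tens A A := univR => /=.
pose s12 : tens (tens A A) A -> tens (tens A A) A :=
  tmap (@tswap k A A) (idfun : {linear A -> A}).
have s12M x y : s12 (x * y) = s12 x * s12 y.
  by apply: tmapM => // u v; apply: tswapM.
have s13 r : s12 (leg13 r) = leg23 r.
  elim/tens_ind: r => [a b|x y ex ey].
    by rewrite leg13E leg23E /s12 tmapE /= tswapE.
  by rewrite /s12 !linearD /= -/(s12 _) -/(s12 _) ex ey.
have s23 r : s12 (leg23 r) = leg13 r.
  elim/tens_ind: r => [a b|x y ex ey].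
    by rewrite leg13E leg23E /s12 tmapE /= tswapE.
  by rewrite /s12 !linearD /= -/(s12 _) -/(s12 _) ex ey.
(* Quasi-cocommutativity in the first two factors; a general [z] in place of R permits induction on
   tensors. *)
have RD z : leg12 R * tmap comul (idfun : {linear A -> A}) z =
    s12 (tmap comul (idfun : {linear A -> A}) z) * leg12 R.
  elim/tens_ind: z => [a b|x y ex ey]; last first.
    by rewrite /s12 !linearD /= mulrDl -/(s12 _) -/(s12 _) -ex -ey mulrDr.
  rewrite leg12_tpure /s12 !tmapE /= !tpureM mul1r mulr1.
  by congr tpure; apply: univR_comulC.
by rewrite -mulrA -univR_hexl RD univR_hexl s12M s13 s23.
Qed.

(** * Transport of the Yang-Baxter equation along regrouping *)

Section MTensorYangBaxter.
Variables (k : fieldType) (I : finType).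

Lemma tswap_mshuffle (V W : I -> lmodType k)
    (z : mtens (fun i => tens (V i) (W i))) :
  tswap (mshuffle z) = mshuffle (mmap (fun i => @tswap k (V i) (W i)) z).
Proof.
move: z; apply: mtens_tens_ext => [a x y|a x y|v w]; rewrite ?linearP //.
rewrite mshuffleE tswapE mmapE -mshuffleE; congr (mshuffle (mpure _)).
by apply: functional_extensionality_dep => i; rewrite [RHS]tswapE.
Qed.

Variable A : I -> algType k.

(** Two regroupings in a row: first split off the third factors, then separate the first from the
    second. *)
Let shuffle3 (z : mtens (fun i => tens (tens (A i) (A i)) (A i))) :
    tens (tens (mtens A) (mtens A)) (mtens A) :=
  tmap (@mshuffle k I A A) (idfun : {linear mtens A -> mtens A}) (mshuffle z).

Let shuffle3M : {morph shuffle3 : x y / x * y}.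
Proof.
move=> x y; rewrite /shuffle3 mshuffleM tmapM // => u v.
exact: mshuffleM.
Qed.

Let shuffle3_leg12 z :
  shuffle3 (mmap (fun i => @leg12 k (A i)) z) = leg12 (mshuffle z).
Proof.
move: z; apply: mtens_tens_ext => [a x y|a x y|v w];
  rewrite /shuffle3 ?linearP // mmapE mshuffleE leg12E.
(* The slot filled with units is the constant family [1], whose [mpure] is the unit of [mtens A] by
   definition. *)
have -> : (fun i => leg12 (tpure (v i) (w i))) =
          fun i => tpure (tpure (v i) (w i)) 1.
  by apply: functional_extensionality_dep => i; rewrite leg12E.
by rewrite (mshuffleE (fun i => tpure (v i) (w i))) tmapE /= mshuffleE.
Qed.

Let shuffle3_leg13 z :
  shuffle3 (mmap (fun i => @leg13 k (A i)) z) = leg13 (mshuffle z).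
Proof.
move: z; apply: mtens_tens_ext => [a x y|a x y|v w];
  rewrite /shuffle3 ?linearP // mmapE mshuffleE leg13E.
have -> : (fun i => leg13 (tpure (v i) (w i))) =
          fun i => tpure (tpure (v i) 1) (w i).
  by apply: functional_extensionality_dep => i; rewrite leg13E.
by rewrite (mshuffleE (fun i => tpure (v i) 1)) tmapE /= mshuffleE.
Qed.

Let shuffle3_leg23 z :
  shuffle3 (mmap (fun i => @leg23 k (A i)) z) = leg23 (mshuffle z).
Proof.
move: z; apply: mtens_tens_ext => [a x y|a x y|v w];
  rewrite /shuffle3 ?linearP // mmapE mshuffleE leg23E.
have -> : (fun i => leg23 (tpure (v i) (w i))) =
          fun i => tpure (tpure 1 (v i)) (w i).
  by apply: functional_extensionality_dep => i; rewrite leg23E.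
by rewrite (mshuffleE (fun i => tpure 1 (v i))) tmapE /= mshuffleE.
Qed.

(** Since [shuffle3] is multiplicative and carries the factorwise legs to the legs of the regrouped
    element, both sides are images of families that agree index by index. *)
Lemma mshuffle_yang_baxter (r : forall i, tens (A i) (A i)) :
  (forall i, leg12 (r i) * leg13 (r i) * leg23 (r i) =
             leg23 (r i) * leg13 (r i) * leg12 (r i)) ->
  let R := mshuffle (mpure r) in
  leg12 R * leg13 R * leg23 R = leg23 R * leg13 R * leg12 R.
Proof.
move=> yb; rewrite /= -shuffle3_leg12 -shuffle3_leg13 -shuffle3_leg23.
rewrite -!shuffle3M !mmapE !mpureM; congr (shuffle3 (mpure _)).
exact: functional_extensionality_dep.
Qed.

End MTensorYangBaxter.

(** * Braidings on modules: isomorphism and braid relation *)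

Section BraidModule.
Variables (k : fieldType) (A : algType k).
Implicit Types X Y Z : amodule A.

Lemma tswap_tact (B : algType k) (X : amodule A) (Y : amodule B)
    (h : tens A B) (z : tens X Y) :
  tswap (tact h z) = tact (tswap h) (tswap z).
Proof.
have bl : bilinear_for *:%R *:%R (@tact k A B X Y) := act_bilin (tens_amod X Y).
have br : bilinear_for *:%R *:%R (@tact k B A Y X) := act_bilin (tens_amod Y X).
elim/tens_ind: h => [a b|h h' eh eh']; last first.
  by rewrite (linD (bl.1 z)) !linearD /= eh eh' (linD (br.1 _)).
elim/tens_ind: z => [x y|z z' ez ez']; last first.
  by rewrite (linD (bl.2 _)) !linearD /= ez ez' (linD (br.2 _)).
by rewrite tactE !tswapE tactE.
Qed.

Lemma braid_amod_iso (D : {lrmorphism A -> tens A A}) (R R' : tens A A) X Y :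
  R * R' = 1 -> R' * R = 1 -> (forall a, R * D a = tswap (D a) * R) ->
  amod_iso (comul_amod D X Y) (comul_amod D Y X) (braid R X Y).
Proof.
move=> RR' R'R RD; split=> [a x y||a z]; first exact: linearP.
  (* The inverse undoes the two stages of the braiding in reverse order: swap back, then act by
     [R']. *)
  exists (fun z => act R' (tswap z : tens_amod X Y)) => z.
    by rewrite /braid tswapK -actM R'R act1.
  by rewrite /braid -actM RR' act1 tswapK.
(* Moving [R] past [D a] leaves [tswap (D a)] outside; the swap of modules then turns it back into
   [D a]. *)
rewrite /braid [act a z]/(act (D a) (z : tens_amod X Y)) -actM RD actM.
by rewrite [LHS]tswap_tact tswapK.
Qed.

Definition swap12 (X Y Z : lmodType k) :
    tens (tens X Y) Z -> tens (tens Y X) Z :=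
  tmap (@tswap k X Y) (idfun : {linear Z -> Z}).

(** Triple products stay bracketed to the left, so the last two factors are reached by reassociating
    and back. *)
Definition swap23 (X Y Z : lmodType k) (z : tens (tens X Y) Z) :
    tens (tens X Z) Y :=
  tassocV (tmap (idfun : {linear X -> X}) (@tswap k Y Z) (tassoc z)).

Lemma swap12_linear (X Y Z : lmodType k) : linear (@swap12 X Y Z).
Proof. by move=> a x y; rewrite /swap12 linearP. Qed.

Lemma swap23_linear (X Y Z : lmodType k) : linear (@swap23 X Y Z).
Proof. by move=> a x y; rewrite /swap23 !linearP. Qed.

Lemma swap12E (X Y Z : lmodType k) (x : X) (y : Y) (z : Z) :
  swap12 (tpure (tpure x y) z) = tpure (tpure y x) z.
Proof. by rewrite /swap12 tmapE /= tswapE. Qed.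

Lemma swap23E (X Y Z : lmodType k) (x : X) (y : Y) (z : Z) :
  swap23 (tpure (tpure x y) z) = tpure (tpure x z) y.
Proof. by rewrite /swap23 tassocE tmapE /= tswapE tassocVE. Qed.

Lemma tens3_ext (X Y Z P : lmodType k) (f g : tens (tens X Y) Z -> P) :
  linear f -> linear g ->
  (forall x y z, f (tpure (tpure x y) z) = g (tpure (tpure x y) z)) ->
  f =1 g.
Proof.
move=> lf lg e; apply: tens_ext => // t z.
elim/tens_ind: t => [x y|t t' et et']; first exact: e.
by rewrite !(linD ((tpure_bilin _ _).1 z)) (linD lf) (linD lg) et et'.
Qed.

(** The braid relation between adjacent transpositions in the symmetric group on three letters: both
    sides reverse the factors. *)
Lemma swap_braid (X Y Z : lmodType k) (t : tens (tens X Y) Z) :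
  swap12 (swap23 (swap12 t)) = swap23 (swap12 (swap23 t)).
Proof.
move: t; apply: tens3_ext => [a x y|a x y|x y z].
- by rewrite swap12_linear swap23_linear swap12_linear.
- by rewrite swap23_linear swap12_linear swap23_linear.
- by rewrite !(swap12E, swap23E).
Qed.

Definition act3 X Y Z (h : tens (tens A A) A) (t : tens (tens X Y) Z) :
    tens (tens X Y) Z :=
  act h (t : tens_amod (tens_amod X Y) Z).

Lemma act3_linearl X Y Z t : linear (fun h => @act3 X Y Z h t).
Proof. exact: (act_bilin (tens_amod (tens_amod X Y) Z)).1. Qed.

Lemma act3_linearr X Y Z h : linear (@act3 X Y Z h).
Proof. exact: (act_bilin (tens_amod (tens_amod X Y) Z)).2. Qed.

Lemma act3M X Y Z h h' t : @act3 X Y Z (h * h') t = act3 h (act3 h' t).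
Proof. exact: (@actM _ _ (tens_amod (tens_amod X Y) Z)). Qed.

Lemma act3E X Y Z a b c (x : X) (y : Y) (z : Z) :
  act3 (tpure (tpure a b) c) (tpure (tpure x y) z) =
  tpure (tpure (act a x) (act b y)) (act c z).
Proof.
rewrite -tactE; exact: (@tactE _ _ _ (tens_amod X Y) Z).
Qed.

(** Both sides are linear in [r] and in [t], so pure tensors suffice; [f] and [g] are to be leg
    embeddings. *)
Lemma act3_swap12 X Y Z (f g : {linear tens A A -> tens (tens A A) A}) :
  (forall a b (x : X) (y : Y) (z : Z),
     act3 (f (tpure a b)) (swap12 (tpure (tpure x y) z)) =
     swap12 (act3 (g (tpure a b)) (tpure (tpure x y) z))) ->
  forall r (t : tens (tens X Y) Z),
    act3 (f r) (swap12 t) = swap12 (act3 (g r) t).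
Proof.
move=> e r t; elim/tens_ind: r => [a b|r r' er er']; last first.
  rewrite !linearD /= (linD (act3_linearl _)) er er'.
  by rewrite -(linD (@swap12_linear _ _ _)) -(linD (act3_linearl _)).
move: t; apply: tens3_ext => [c t t'|c t t'|x y z]; last exact: e.
  by rewrite swap12_linear act3_linearr.
by rewrite act3_linearr swap12_linear.
Qed.

Lemma act3_swap23 X Y Z (f g : {linear tens A A -> tens (tens A A) A}) :
  (forall a b (x : X) (y : Y) (z : Z),
     act3 (f (tpure a b)) (swap23 (tpure (tpure x y) z)) =
     swap23 (act3 (g (tpure a b)) (tpure (tpure x y) z))) ->
  forall r (t : tens (tens X Y) Z),
    act3 (f r) (swap23 t) = swap23 (act3 (g r) t).
Proof.
move=> e r t; elim/tens_ind: r => [a b|r r' er er']; last first.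
  rewrite !linearD /= (linD (act3_linearl _)) er er'.
  by rewrite -(linD (@swap23_linear _ _ _)) -(linD (act3_linearl _)).
move: t; apply: tens3_ext => [c t t'|c t t'|x y z]; last exact: e.
  by rewrite swap23_linear act3_linearr.
by rewrite act3_linearr swap23_linear.
Qed.

(** First of four rules by which a swap moves left past a leg: the transposition acts on the indices
    of the leg. *)
Lemma leg23_swap12 X Y Z r (t : tens (tens X Y) Z) :
  act3 (leg23 r) (swap12 t) = swap12 (act3 (leg13 r) t).
Proof.
apply: act3_swap12 => a b x y z /=.
by rewrite leg23E leg13E !(swap12E, act3E) !act1.
Qed.

Lemma leg13_swap12 X Y Z r (t : tens (tens X Y) Z) :
  act3 (leg13 r) (swap12 t) = swap12 (act3 (leg23 r) t).
Proof.
apply: act3_swap12 => a b x y z /=.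
by rewrite leg23E leg13E !(swap12E, act3E) !act1.
Qed.

Lemma leg12_swap23 X Y Z r (t : tens (tens X Y) Z) :
  act3 (leg12 r) (swap23 t) = swap23 (act3 (leg13 r) t).
Proof.
apply: act3_swap23 => a b x y z /=.
by rewrite leg12E leg13E !(swap23E, act3E) !act1.
Qed.

Lemma leg13_swap23 X Y Z r (t : tens (tens X Y) Z) :
  act3 (leg13 r) (swap23 t) = swap23 (act3 (leg12 r) t).
Proof.
apply: act3_swap23 => a b x y z /=.
by rewrite leg12E leg13E !(swap23E, act3E) !act1.
Qed.

Lemma braidD X Y r r' (t : tens X Y) :
  braid (r + r') X Y t = braid r X Y t + braid r' X Y t.
Proof.
by rewrite /braid (linD ((act_bilin (tens_amod X Y)).1 t)) linearD.
Qed.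

Lemma braid12E X Y Z r (t : tens (tens X Y) Z) :
  tmap (braid r X Y) (idfun : {linear Z -> Z}) t = swap12 (act3 (leg12 r) t).
Proof.
move: t; apply: tens_ext => [a t t'|a t t'|t z]; rewrite ?linearP //.
  by rewrite act3_linearr swap12_linear.
rewrite tmapE leg12_tpure /act3.
rewrite [act _ _](@tactE _ _ _ (tens_amod X Y) Z) act1.
by rewrite /swap12 tmapE.
Qed.

Lemma braid23E X Y Z r (t : tens (tens X Y) Z) :
  tassocV (tmap (idfun : {linear X -> X}) (braid r Y Z) (tassoc t)) =
  swap23 (act3 (leg23 r) t).
Proof.
(* Unlike [leg12 r], the element [leg23 r] is not visibly pure for the left bracketing, so [r]
   itself is decomposed. *)
elim/tens_ind: r => [a b|r r' er er']; last first.
  rewrite linearD /= (linD (act3_linearl _)) (linD (@swap23_linear _ _ _)).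
  rewrite -er -er' -!linearD /=; congr tassocV.
  elim/tens_ind: (tassoc t) => [x u|u u' eu eu']; last first.
    by rewrite !linearD /= eu eu' addrACA.
  by rewrite !tmapE /= braidD (linD ((tpure_bilin _ _).2 x)).
move: t; apply: tens3_ext => [c t t'|c t t'|x y z].
- by rewrite !linearP.
- by rewrite act3_linearr swap23_linear.
rewrite leg23E act3E act1 swap23E tassocE tmapE /=.
by rewrite /braid [act _ _]tactE tswapE tassocVE.
Qed.

Lemma braid_yang_baxter (R : tens A A) X Y Z :
  leg12 R * leg13 R * leg23 R = leg23 R * leg13 R * leg12 R ->
  forall z : tens (tens X Y) Z,
     tmap (braid R Y Z) (idfun : {linear X -> X})
       (tassocV (tmap (idfun : {linear Y -> Y}) (braid R X Z)
         (tassoc (tmap (braid R X Y) (idfun : {linear Z -> Z}) z)))) =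
     tassocV (tmap (idfun : {linear Z -> Z}) (braid R X Y)
       (tassoc (tmap (braid R X Z) (idfun : {linear Y -> Y})
         (tassocV (tmap (idfun : {linear X -> X}) (braid R Y Z)
           (tassoc z)))))).
Proof.
move=> yb z; rewrite !(braid12E, braid23E).
rewrite !(leg23_swap12, leg12_swap23, leg13_swap12, leg13_swap23).
(* With all swaps outside, [swap_braid] matches them, and [yb] matches the products of legs. *)
by rewrite swap_braid -!act3M yb.
Qed.

End BraidModule.

Theorem mainTheorem1 (k : fieldType) (n : nat) (n_gt0 : (0 < n)%N)
    (H : 'I_n -> qthopfType k)
    (J : 'I_n -> finType) (s t : forall m, J m -> H m)
    (univR_st : forall m,
      (univR : tens (H m) (H m)) = \sum_(i : J m) tpure (s m i) (t m i))
    (U V W : forall m, amodule (H m)) :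
  let R : tens (mtens H) (mtens H) :=
    \sum_(i : {dffun forall m, J m})
      tpure (mpure (fun m => s m (i m))) (mpure (fun m => t m (i m))) in
  let Ut : amodule (mtens H) := mtens_amod U in
  let Vt : amodule (mtens H) := mtens_amod V in
  let Wt : amodule (mtens H) := mtens_amod W in
  amod_iso (comul_amod (mcomul H) Vt Wt) (comul_amod (mcomul H) Wt Vt)
    (braid R Vt Wt) /\
  (forall z : tens (tens Ut Vt) Wt,
     tmap (braid R Vt Wt) idfun
       (tassocV (tmap idfun (braid R Ut Wt)
         (tassoc (tmap (braid R Ut Vt) idfun z)))) =
     tassocV (tmap idfun (braid R Ut Vt)
       (tassoc (tmap (braid R Ut Wt) idfun
         (tassocV (tmap idfun (braid R Vt Wt) (tassoc z))))))).
Proof.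
pose r m : tens (H m) (H m) := univR.
pose r' m : tens (H m) (H m) := univRV.
(* Multilinear expansion: each choice of one summand from every R-matrix contributes one term, and
   regrouping sends it to the matching term of R. *)
have RE : \sum_(i : {dffun forall m, J m})
      tpure (mpure (fun m => s m (i m))) (mpure (fun m => t m (i m))) =
    mshuffle (mpure r).
  have -> : r = fun m => \sum_j tpure (s m j) (t m j).
    exact: functional_extensionality_dep.
  rewrite (multilinear_sum (@mpure_multilinear _ _ _)) raddf_sum.
  apply: eq_bigr => i _; apply: esym.
  exact: (mshuffleE (fun m => s m (i m)) (fun m => t m (i m))).
move=> R Ut Vt Wt; rewrite /R RE; split; last first.
  apply: braid_yang_baxter; apply: mshuffle_yang_baxter => m.
  exact: univR_yang_baxter.
(* The inverse of R is the regrouping of the family of inverses of the R-matrices. *)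
apply: (@braid_amod_iso _ _ _ _ (mshuffle (mpure r'))) => [||a].
- rewrite -mshuffleM mpureM -mshuffle1 -mpure1; congr (mshuffle (mpure _)).
  by apply: functional_extensionality_dep => m; apply: univR_mulV.
- rewrite -mshuffleM mpureM -mshuffle1 -mpure1; congr (mshuffle (mpure _)).
  by apply: functional_extensionality_dep => m; apply: univR_Vmul.
(* By linearity [a] may be a pure tensor; coproduct, swap and product are then computed factor by
   factor inside [mshuffle]. *)
move: a; apply: mtens_ext => [c x y|c x y|x].
- by rewrite linearP ((mulr_bilin _).2 (mshuffle (mpure r))).
- by rewrite !linearP ((mulr_bilin _).1 (mshuffle (mpure r))).
rewrite [mcomul H _]mcomulE tswap_mshuffle mmapE -!mshuffleM !mpureM.
congr (mshuffle (mpure _)); apply: functional_extensionality_dep => m.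
exact: univR_comulC.
Qed.
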